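(* Let $A\in\mathbb{R}^{N\times N}$ be symmetric and $B\in\{0,1\}^{N\times M}$, with clusters $\mathcal{C}_1,\dots,\mathcal{C}_K$, transformation $T_{or}$, block $A_{\perp}$, set $\Lambda^{\perp}$ and subspaces $\Omega_i$ as defined in the context. Then the Driver Node Selection Algorithm described in the context solves Problem 1: every matrix $D$ it selects satisfies $$D_{\parallel}=0\qquad\text{and}\qquad (A_{\perp},D_{\perp})\ \text{is stabilizable},$$ where $D_{\parallel}=T^{\parallel}D$ and $D_{\perp}=T^{\perp}D$.
   Context: Setting. $\mathrm{aut}(\mathcal{G}(A,B))$ is the group of $N\times N$ permutation matrices $P$ with $PA=AP$ and $PB=B$, acting on the node set $\{1,\dots,N\}$; its orbits (clusters) $\mathcal{C}_1,\dots,\mathcal{C}_K$ partition the nodes. The group consensus subspace is $\mathcal{X}_{or}=\{x\in\mathbb{R}^N:\ x_i=x_l\ \forall i,l\in\mathcal{C}_j,\ \forall j\}$; it is $A$-invariant. $T_{or}=\begin{bmatrix} T^{\parallel} \\ T^{\perp} \end{bmatrix}\in\mathbb{R}^{N\times N}$ is an orthogonal matrix (the irreducible-representation transformation) with $T^{\parallel}\in\mathbb{R}^{K\times N}$, $T^{\parallel}_{ij}=|\mathcal{C}_i|^{-1/2}$ if $j\in\mathcal{C}_i$ and $0$ otherwise; the rows of $T^{\perp}\in\mathbb{R}^{(N-K)\times N}$ form a basis of the orthogonal complement of $\mathcal{X}_{or}$, and each row of $T^{\perp}$ has nonzero entries only at nodes of a single cluster. One has $T_{or}AT_{or}^T=\begin{bmatrix}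 A_{\parallel} & 0 \\ 0 & A_{\perp} \end{bmatrix}$. Additional inputs. The network with additional inputs $w\in\mathbb{R}^W$ is $\dot x=Ax+Bu+Dw$ with $D\in\mathbb{R}^{N\times W}$, and $T_{or}D=\begin{bmatrix} D_{\parallel} \\ D_{\perp} \end{bmatrix}$. Problem 1: select a matrix $D$ such that $D_{\parallel}=0$ and $(A_{\perp},D_{\perp})$ is stabilizable (in the usual continuous-time sense; equivalently, every eigenvalue of $A_{\perp}$ with nonnegative real part is controllable for $(A_\perp,D_\perp)$, i.e., for each eigenvector $v$ of $A_{\perp}^T$ associated with it there is a column $d$ of $D_{\perp}$ with $v^Td\ne0$). Notation. $\Lambda^{\perp}$ is the set of (distinct) eigenvalues of $A$ with nonnegative real part that are also eigenvalues of $A_{\perp}$, enumerated as $\lambda_1,\dots,\lambda_{|\Lambda^\perp|}$. For $\lambda_i\in\Lambda^{\perp}$, $\Omega_i$ is the subspace of the eigenspace of $A$ for $\lambda_i$ consisting of vectors orthogonal to $\mathcal{X}_{or}$, $\mu_i=\dim\Omega_i$, and $\mathrm{proj}_{\Omega_i}$ is the orthogonal projection onto $\Omega_i$. Driver Node Selection Algorithm. Start with $D$ the empty matrix. For $i=1,\dots,|\Lambda^{\perp}|$ in turn: let $h_i$ be the (maximal) number of columns of the current $D$ whose projections on $\Omega_i$ are nonzero and linearly independent; then append to $D$, one at a time, $\mu_i-h_i$ new columns $D_j\in\mathbb{R}^N$, each chosen so that $\mathrm{proj}_{\Omega_i}(D_j)$ is nonzero and linearly independent of the projections on $\Omega_i$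 of the columns already in $D$, and so that $\sum_{k\in\mathcal{C}_l}D_j(k)=0$ for every $l=1,\dots,K$. The matrix obtained after the last $i$ is the matrix $D$ selected by the algorithm. *)

(* Defs.v *)
From HB Require Import structures.
From mathcomp Require Import all_boot all_order all_algebra all_fingroup.
From mathcomp Require Import complex reals.

Set Implicit Arguments.
Unset Strict Implicit.
Unset Printing Implicit Defensive.

Import Order.TTheory GRing.Theory Num.Theory.
Local Open Scope ring_scope.

Section Clusters.
Variables (R : realType) (N M : nat).
Implicit Types (A : 'M[R]_N) (B : 'M[R]_(N, M)).

(* The permutation [s] stands for the permutation matrix [perm_mx s]; whether
   that matrix moves nodes by [s] or by its inverse does not affect orbits. *)
Definition aut A B : {set 'S_N} :=
  [set s : 'S_N | (perm_mx s *m A == A *m perm_mx s) && (perm_mx s *m B == B)].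

Lemma aut_group_set A B : group_set (aut A B).
Proof.
apply/group_setP; split=> [|s t].
  by rewrite inE perm_mx1 !mul1mx mulmx1 !eqxx.
rewrite !inE => /andP[/eqP sA /eqP sB] /andP[/eqP tA /eqP tB].
by rewrite perm_mxM -!mulmxA tA tB sB mulmxA sA -mulmxA !eqxx.
Qed.

Canonical aut_group A B := Group (aut_group_set A B).

Definition clusters A B : {set {set 'I_N}} :=
  [set orbit 'P (aut A B) i | i : 'I_N].

Definition cluster_enum A B K (C : 'I_K -> {set 'I_N}) : Prop :=
  injective C /\ [set C j | j : 'I_K] = clusters A B.

End Clusters.

Section Orthogonality.
Variables (R : realType) (N : nat).
Implicit Types (U : {vspace 'cV[R]_N}) (v : 'cV[R]_N).

Definition basis_rows U : 'M[R]_(\dim U, N) :=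
  \matrix_(i < \dim U, j < N) (vbasis U)`_i j 0.

Definition orthv U : {vspace 'cV[R]_N} := lker (linfun (mulmx (basis_rows U))).

Lemma memv_orthv U v :
  reflect {in U, forall u, u^T *m v = 0} (v \in orthv U).
Proof.
rewrite memv_ker lfunE /=; apply: (iffP eqP) => [Uv u Uu | Uv].
  rewrite (coord_vbasis Uu) linear_sum mulmx_suml big1 // => i _ /=.
  rewrite linearZ /= -scalemxAl (_ : _ *m v = 0) ?scaler0 //.
  apply/matrixP=> a b; move/matrixP/(_ i b): Uv; rewrite !mxE => Uv.
  by rewrite -[RHS]Uv; apply: eq_bigr => k _; rewrite !mxE ord1.
apply/matrixP=> i b.
have /Uv/matrixP/(_ 0 b) : (vbasis U)`_i \in U.
  by rewrite vbasis_mem // mem_nth // size_tuple.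
by rewrite !mxE => Ub; rewrite -[RHS]Ub; apply: eq_bigr => k _; rewrite !mxE.
Qed.

Definition oproj U : 'End('cV[R]_N) := daddv_pi U (orthv U).

Lemma capv_orthv U : (U :&: orthv U = 0)%VS.
Proof.
apply/eqP; rewrite -subv0; apply/subvP=> v /memv_capP[Uv /memv_orthv/(_ v Uv)].
move=> /matrixP/(_ 0 0); rewrite !mxE memv0 => /eqP.
rewrite psumr_eq0 => [/allP v0|k _]; last by rewrite mxE -expr2 sqr_ge0.
apply/eqP/matrixP=> k b; rewrite ord1 mxE.
by have := v0 k (mem_index_enum _); rewrite mxE mulf_eq0 orbb => /eqP.
Qed.

Lemma addv_orthv U : (U + orthv U = fullv)%VS.
Proof.
apply/eqP; rewrite eqEdim subvf dimv_disjoint_sum ?capv_orthv //=.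
rewrite -(limg_ker_dim (linfun (mulmx (basis_rows U))) fullv) capfv addnC.
by rewrite leq_add2r (leq_trans (dimvS (subvf _))) // dimvf dim_matrix [leqLHS]muln1 leqnn.
Qed.

Lemma oprojP U v : oproj U v \in U /\ v - oproj U v \in orthv U.
Proof.
split; first exact: memv_pi.
have Uv : v \in (U + orthv U)%VS by rewrite addv_orthv memvf.
suff -> : v - oproj U v = daddv_pi (orthv U) U v by exact: memv_pi.
apply/eqP; rewrite subr_eq addrC eq_sym; apply/eqP.
exact: daddv_pi_add (capv_orthv U) Uv.
Qed.

End Orthogonality.

Section Network.
Variables (R : realType) (N K : nat).
Implicit Types (A : 'M[R]_N) (C : 'I_K -> {set 'I_N}).
Implicit Types (Tperp : 'M[R]_(N - K, N)).

Definition Xor C : {vspace 'cV[R]_N} :=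
  (\bigcap_(j < K) \bigcap_(i in C j) \bigcap_(l in C j)
     lker (linfun (mulmx (delta_mx 0 i - delta_mx 0 l : 'rV[R]_N)%R)))%VS.

Lemma memv_Xor C (x : 'cV[R]_N) :
  reflect (forall j, {in C j &, forall i l, x i 0 = x l 0}) (x \in Xor C).
Proof.
have lk (i l : 'I_N) : ((x \in
    lker (linfun (mulmx (delta_mx 0 i - delta_mx 0 l : 'rV[R]_N)%R)))%VS)
    = (x i 0 == x l 0).
  rewrite memv_ker lfunE /= mulmxBl -!rowE subr_eq0.
  apply/eqP/eqP => [/matrixP/(_ 0 0)|xil]; first by rewrite !mxE.
  by apply/matrixP=> a b; rewrite !mxE !ord1.
apply: (iffP idP) => [Xx j i l Ci Cl|Xx].
  apply/eqP; rewrite -lk; rewrite memvE; move: Xx; rewrite memvE.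
  by move=> /subv_bigcapP/(_ j isT)/subv_bigcapP/(_ i Ci)/subv_bigcapP/(_ l Cl).
rewrite memvE; apply/subv_bigcapP=> j _; apply/subv_bigcapP=> i Ci.
by apply/subv_bigcapP=> l Cl; rewrite -memvE lk; apply/eqP/(Xx j).
Qed.

Definition Tpar C : 'M[R]_(K, N) :=
  \matrix_(i < K, j < N) if j \in C i then (Num.sqrt #|C i|%:R)^-1 else 0.

Definition Tor C Tperp : 'M[R]_(K + (N - K), N) := col_mx (Tpar C) Tperp.

(* Both orthogonality equations are stated because [K + (N - K)] and [N] are
   not syntactically the same dimension. *)
Definition irr_transformation C Tperp : Prop :=
  [/\ Tor C Tperp *m (Tor C Tperp)^T = 1%:M,
      (Tor C Tperp)^T *m Tor C Tperp = 1%:M,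
      basis_of (orthv (Xor C)) [seq (row i Tperp)^T | i : 'I_(N - K)]
    & forall i, exists l, forall j, Tperp i j != 0 -> j \in C l].

Definition Aperp A C Tperp : 'M[R]_(N - K) :=
  drsubmx (Tor C Tperp *m A *m (Tor C Tperp)^T).

(* [A], hence also [Aperp], is meant to be symmetric: all eigenvalues are real,
   so "nonnegative real part" reads [0 <= l]. *)
Definition Lambda_perp A C Tperp : pred R :=
  [pred l | [&& eigenvalue A l, 0 <= l & eigenvalue (Aperp A C Tperp) l]].

Definition Lambda_perp_enum A C Tperp (lam : seq R) : Prop :=
  uniq lam /\ lam =i Lambda_perp A C Tperp.

Definition Omega A C (l : R) : {vspace 'cV[R]_N} :=
  (passmx.leigenspace (linfun (mulmx A)) l :&: orthv (Xor C))%VS.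

Lemma memv_Omega A C (l : R) (v : 'cV[R]_N) :
  reflect (A *m v = l *: v /\ {in Xor C, forall x, x^T *m v = 0})
          (v \in Omega A C l).
Proof.
rewrite memv_cap memv_ker !lfun_simp subr_eq0.
by apply: (iffP andP) => -[/eqP Av /memv_orthv Xv].
Qed.

End Network.

Section Stabilizability.
Variable R : realType.

Definition hurwitz n (F : 'M[R]_n) : Prop :=
  forall z : R[i], eigenvalue (map_mx (real_complex R) F) z -> complex.Re z < 0.

Definition stabilizable n m (F : 'M[R]_n) (G : 'M[R]_(n, m)) : Prop :=
  exists L : 'M[R]_(m, n), hurwitz (F + G *m L).

End Stabilizability.

Section Selection.
Variables (R : realType) (N K : nat) (C : 'I_K -> {set 'I_N}).
Implicit Types (U : {vspace 'cV[R]_N}) (D : seq 'cV[R]_N) (d : 'cV[R]_N).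

(* The matrix under construction is the sequence of its columns. *)
Definition mx_of_cols D : 'M[R]_(N, size D) := \matrix_(k, j) D`_j k 0.

(* [free] includes nonvanishing of the listed vectors. *)
Definition proj_count U D : nat :=
  \max_(S : {set 'I_(size D)} |
      free [seq oproj U D`_j | j : 'I_(size D) in S]) #|S|.

Lemma proj_count_le U D : (proj_count U D <= \dim U)%N.
Proof.
apply/bigmax_leqP=> S /eqP; rewrite size_image => <-.
apply/dimvS/span_subvP=> _ /imageP[j _ ->]; exact: memv_pi.
Qed.

Definition admissible U D d : Prop :=
  [/\ oproj U d != 0,
      oproj U d \notin <<[seq oproj U c | c <- D]>>%VS
    & forall l : 'I_K, \sum_(k in C l) d k 0 = 0].

(* [append_cols U n D D']: [D'] is [D] followed by [n] columns, each one
   admissible at the time it is added. *)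
Inductive append_cols U : nat -> seq 'cV[R]_N -> seq 'cV[R]_N -> Prop :=
| AppendNone D : append_cols U 0 D D
| AppendCol n D d D' :
    admissible U D d -> append_cols U n (rcons D d) D' ->
    append_cols U n.+1 D D'.

(* The truncated subtraction is exact by [proj_count_le]. *)
Inductive selection_run (A : 'M[R]_N) :
  seq R -> seq 'cV[R]_N -> seq 'cV[R]_N -> Prop :=
| RunDone D : selection_run A [::] D D
| RunStep l ls D D' D'' :
    append_cols (Omega A C l)
      (\dim (Omega A C l) - proj_count (Omega A C l) D) D D' ->
    selection_run A ls D' D'' ->
    selection_run A (l :: ls) D D''.

Definition selected (A : 'M[R]_N) (lam : seq R) D : Prop :=
  selection_run A lam [::] D.

End Selection.

(* Main.v *)
Require Import Defs.
From mathcomp Require Import all_boot all_order all_algebra all_fingroup.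
From mathcomp Require Import complex reals boolp.
From mathcomp Require Import ring lra.

Set Implicit Arguments.
Unset Strict Implicit.
Unset Printing Implicit Defensive.

Import Order.TTheory GRing.Theory Num.Theory.
Local Open Scope ring_scope.

(** Why the selection works.

    A column whose entries sum to zero over each cluster is orthogonal to every
    indicator vector of a cluster, hence killed by the rows of [Tpar]; since
    only such columns are appended, [Tpar *m D = 0].

    For stabilizability, consider a left eigenvector [w] of [Aperp] for an
    eigenvalue [a >= 0].  Automorphisms commute with [A], so [A] preserves the
    vectors constant on clusters; therefore [Tperp] intertwines [Aperp] and [A]
    ([Aperp_intertwine]) and [w *m Tperp] lies, transposed, in the space
    [Omega A C a], with [a] one of the enumerated eigenvalues.  When [a] is
    treated, the projections of the present columns span at least [proj_count]
    dimensions and each new column adds one, so at the end of the step, and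
    forever after, the projections span all of [Omega A C a]
    ([selection_run_spec]).  A vector of [Omega A C a] orthogonal to all columns
    is then orthogonal to itself.  Hence [w *m (Tperp *m D) = 0] forces [w = 0]:
    every nonnegative eigenvalue of [Aperp] passes the Popov-Belevitch-Hautus
    test.

    It remains to turn that test into a stabilizing feedback, for a symmetric
    [F] and input matrix [G] ([sym_stabilizable]).  Let the rows of [V] be a
    maximal orthonormal family of eigenvectors of [F] with eigenvalues
    [d_i >= 0] ([exhausting_eigenframe]), so that [V *m F = diag d *m V], and
    put [g = V *m G].  Following Bass, solve explicitly the equation
    [diag d *m Z + Z *m (diag d + 2) = g *m g^T].  The kernel of [Z] is killed by
    [g] and invariant under [diag d]; were it nonzero it would contain an
    eigenvector violating the test, so [Z] is invertible.  With
    [L1 = - g^T *m Z^-1] the equation reads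
    [(diag d + g *m L1) *m Z = - Z *m (diag d + 2)]: the closed loop is similar
    to a negative diagonal matrix ([diag_stabilizable]).  The feedback
    [L1 *m V] leaves the action of [F] on the orthogonal complement of the rows
    of [V] unchanged modulo that row space, and by maximality only negative
    eigenvalues live there. *)

Local Notation cmx := (map_mx (real_complex _)).
Local Notation Remx := (map_mx (@complex.Re _)).
Local Notation Immx := (map_mx (@complex.Im _)).

(** * Eigenvectors of real symmetric matrices *)

Section RealImaginaryParts.
Variable R : rcfType.

Lemma Remx_mul m n p (u : 'M[R[i]]_(m, n)) (M : 'M[R]_(n, p)) :
  Remx (u *m cmx M) = Remx u *m M.
Proof.
apply/matrixP=> i j; rewrite !mxE.
rewrite (big_morph (@complex.Re R) (id1 := 0) (op1 := +%R)) //; last by case=> a b [].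
apply: eq_bigr => k _; rewrite !mxE; case: (u i k) => a b /=.
by rewrite mulr0 subr0.
Qed.

Lemma Immx_mul m n p (u : 'M[R[i]]_(m, n)) (M : 'M[R]_(n, p)) :
  Immx (u *m cmx M) = Immx u *m M.
Proof.
apply/matrixP=> i j; rewrite !mxE.
rewrite (big_morph (@complex.Im R) (id1 := 0) (op1 := +%R)) //; last by case=> a b [].
apply: eq_bigr => k _; rewrite !mxE; case: (u i k) => a b /=.
by rewrite mulr0 add0r.
Qed.

Lemma complex_mx_eq0 m p (u : 'M[R[i]]_(m, p)) :
  Remx u = 0 -> Immx u = 0 -> u = 0.
Proof.
move=> /matrixP a0 /matrixP b0; apply/matrixP=> i j.
move: (a0 i j) (b0 i j); rewrite !mxE; case: (u i j) => a b /= -> -> //.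
Qed.

End RealImaginaryParts.

Section SymmetricSpectrum.
Variables (R : rcfType) (n : nat) (F : 'M[R]_n).
Hypothesis F_sym : F^T = F.

Lemma row_dotE (x : 'rV[R]_n) : (x *m x^T) 0 0 = \sum_i x 0 i ^+ 2.
Proof. by rewrite mxE; apply: eq_bigr => i _; rewrite mxE expr2. Qed.

Lemma row_dot_ge0 (x : 'rV[R]_n) : 0 <= (x *m x^T) 0 0.
Proof. by rewrite row_dotE sumr_ge0 // => i _; apply: sqr_ge0. Qed.

Lemma row_dot_eq0 (x : 'rV[R]_n) : (x *m x^T) 0 0 = 0 -> x = 0.
Proof.
rewrite row_dotE => /eqP; rewrite psumr_eq0 => [/allP x0|i _]; last exact: sqr_ge0.
apply/rowP=> i; apply/eqP; rewrite mxE -sqrf_eq0.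
exact: x0 (mem_index_enum _).
Qed.

Lemma sym_mx_dot_comm (x y : 'rV[R]_n) :
  (x *m F *m y^T) 0 0 = (y *m F *m x^T) 0 0.
Proof.
have -> : (y *m F *m x^T) 0 0 = (y *m F *m x^T)^T 0 0 by rewrite [RHS]mxE.
by rewrite !trmx_mul trmxK F_sym mulmxA.
Qed.

(** With [a + ib] the eigenvector and [s + it] the eigenvalue, symmetry equates
    the two cross terms [aFb^T] and [bFa^T], which gives
    [t (|a|^2 + |b|^2) = 0]: either [t = 0] or the vector vanishes. *)
Lemma sym_complex_eigenvector (u : 'rV[R[i]]_n) z : u *m cmx F = z *: u ->
  Remx u *m F = complex.Re z *: Remx u /\ Immx u *m F = complex.Re z *: Immx u.
Proof.
move=> uF; set a := Remx u; set b := Immx u; set s := complex.Re z.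
pose t := complex.Im z.
have aF : a *m F = s *: a - t *: b.
  rewrite -Remx_mul uF; apply/rowP=> j; rewrite !mxE /s /t.
  by case: (z) (u 0 j) => ? ? [? ?].
have bF : b *m F = s *: b + t *: a.
  rewrite -Immx_mul uF; apply/rowP=> j; rewrite !mxE /s /t.
  by case: (z) (u 0 j) => ? ? [? ?].
have /eqP : t * ((a *m a^T) 0 0 + (b *m b^T) 0 0) = 0.
  have abC : (a *m b^T) 0 0 = (b *m a^T) 0 0.
    by rewrite !mxE; apply: eq_bigr => i _; rewrite !mxE mulrC.
  have := sym_mx_dot_comm a b; rewrite aF bF mulmxBl mulmxDl -!scalemxAl.
  have entry k l : forall x y : 'M[R]_1,
    (k *: x + l *: y) 0 0 = k * x 0 0 + l * y 0 0 by move=> x y; rewrite !mxE.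
  rewrite -scaleNr !entry abC; lra.
rewrite mulf_eq0 => /orP[/eqP t0|].
  by rewrite aF bF t0 !scale0r subr0 addr0.
rewrite paddr_eq0 ?row_dot_ge0 // => /andP[/eqP/row_dot_eq0 a0 /eqP/row_dot_eq0 b0].
by rewrite a0 b0 !mul0mx !scaler0.
Qed.

(** The matrix of [F] on a basis of [U] has a complex eigenvalue, like any square
    matrix of positive size; its eigenvector, seen in the ambient space, has real
    and imaginary parts that are real eigenvectors of [F], one of them nonzero. *)
Lemma sym_stable_eigenvector m (U : 'M[R]_(m, n)) :
    stablemx U F -> U != 0 ->
  exists (v : 'rV[R]_n) (a : R), [/\ v != 0, (v <= U)%MS & v *m F = a *: v].
Proof.
move=> UF U0; pose W := row_base U.
have WF : (W *m F <= W)%MS.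
  by rewrite eq_row_base (submx_trans _ UF) // submxMr // eq_row_base.
pose X := W *m F *m pinvmx W.
have XW : X *m W = W *m F by rewrite mulmxKpV.
have /closed_rootP[z] : size (char_poly (cmx X)) != 1%N.
  by rewrite size_char_poly eqSS mxrank_eq0.
rewrite -eigenvalue_root_char => /eigenvalueP[y yX y0].
pose u := y *m cmx W.
have u0 : u != 0 by rewrite mulmx_free_eq0 // row_free_map row_base_free.
have /sym_complex_eigenvector[aF bF] : u *m cmx F = z *: u.
  by rewrite -mulmxA -map_mxM -XW map_mxM mulmxA yX scalemxAl.
have sub (c : 'rV_ _) : (c *m W <= U)%MS by rewrite -(eq_row_base U) submxMl.
case: (eqVneq (Remx u) 0) => [a0|a0].
  exists (Immx u), (complex.Re z); split=> //; last by rewrite /u Immx_mul.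
  by apply: contra_neq u0; apply: complex_mx_eq0.
by exists (Remx u), (complex.Re z); split=> //; rewrite /u Remx_mul.
Qed.

End SymmetricSpectrum.

(** * Maximal orthonormal families of eigenvectors *)

Section Eigenframe.
Variables (R : rcfType) (n : nat) (F : 'M[R]_n).

Definition eigenframe (p : pred R) k (V : 'M[R]_(k, n)) (d : 'rV[R]_k) : Prop :=
  [/\ V *m V^T = 1%:M, V *m F = diag_mx d *m V & forall i, p (d 0 i)].

Definition frame_exhausts (p : pred R) k (V : 'M[R]_(k, n)) : Prop :=
  forall (v : 'rV_n) a, v *m V^T = 0 -> v *m F = a *: v -> p a -> v = 0.

Lemma eigenframe_extend p k (V : 'M[R]_(k, n)) d (v : 'rV[R]_n) a :
    eigenframe p V d -> v *m V^T = 0 -> v *m F = a *: v -> p a -> v != 0 ->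
  exists (V' : 'M[R]_(k + 1, n)) d', eigenframe p V' d'.
Proof.
move=> [VV VF pd] vV vF pa v0.
have nv_gt0 : 0 < (v *m v^T) 0 0.
  by rewrite lt_def row_dot_ge0 andbT; apply: contra_neq v0 => /row_dot_eq0.
pose c := (Num.sqrt ((v *m v^T) 0 0))^-1; pose w := c *: v.
have ww : w *m w^T = 1%:M.
  rewrite [LHS]mx11_scalar /w linearZ /= -scalemxAl -scalemxAr !scalerA -expr2 mxE.
  by rewrite exprVn sqr_sqrtr ?ltW // mulVf ?gt_eqF.
have wV : w *m V^T = 0 by rewrite /w -scalemxAl vV scaler0.
exists (col_mx V w), (row_mx d a%:M); split.
- rewrite tr_col_mx mul_col_row VV ww wV -(trmxK (V *m w^T)) trmx_mul trmxK wV.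
  by rewrite trmx0 -scalar_mx_block.
- have -> : diag_mx (row_mx d a%:M) = block_mx (diag_mx d) 0 0 a%:M.
    by rewrite diag_mx_row [diag_mx a%:M]mx11_scalar !mxE.
  rewrite mul_col_mx mul_block_col !mul0mx addr0 add0r VF mul_scalar_mx.
  by rewrite -scalemxAl vF !scalerA mulrC.
- move=> i; rewrite -(splitK i); case: (split i) => j /=.
    by rewrite row_mxEl.
  by rewrite row_mxEr ord1 mxE eqxx.
Qed.

(** Orthonormal rows are independent, so a family that keeps being extended
    would outgrow the dimension. *)
Lemma exhausting_eigenframe p : exists k (V : 'M[R]_(k, n)) d,
  eigenframe p V d /\ frame_exhausts p V.
Proof.
(* [j] bounds the number of extensions still possible. *)
have grow j k (V : 'M[R]_(k, n)) d : (n < k + j)%N -> eigenframe p V d ->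
    exists k (V : 'M[R]_(k, n)) d, eigenframe p V d /\ frame_exhausts p V.
  elim: j k V d => [|j IHj] k V d n_lt frV.
    have [VV _ _] := frV; have : row_free V by apply/row_freeP; exists V^T.
    by rewrite addn0 in n_lt => /eqP rV; have := rank_leq_col V; rewrite rV leqNgt n_lt.
  have [exhV|/existsNP[v]] := pselect (frame_exhausts p V).
    by exists k, V, d.
  move=> /existsNP[a /not_implyP[vV /not_implyP[vF /not_implyP[pa /eqP v0]]]].
  have [V' [d' frV']] := eigenframe_extend frV vV vF pa v0.
  by apply: IHj frV'; rewrite -addnA add1n.
apply: (grow n.+1 0 (0 : 'M_(0, n)) 0); first by rewrite add0n.
by split=> [||[]//]; apply/matrixP=> -[].
Qed.

End Eigenframe.

(** * Stabilizing feedback for symmetric systems *)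

Section SymmetricPBH.
Variables (R : realType).

(** Bass's construction. The solution [Z] of the Lyapunov-type equation is a
    Cauchy-like matrix, explicit because the dynamics is diagonal. *)
Lemma diag_stabilizable k m (d : 'rV[R]_k) (g : 'M[R]_(k, m)) :
    (forall i, 0 <= d 0 i) ->
    (forall (v : 'rV_k) a, v *m diag_mx d = a *: v -> v *m g = 0 -> v = 0) ->
  stabilizable (diag_mx d) g.
Proof.
(* The shift may be any positive number: it makes the denominators of [Z] nonzero
   and places the closed-loop spectrum at the numbers [- e 0 j < 0]. *)
move=> d_ge0 ctrl; pose e : 'rV[R]_k := d + const_mx 2.
pose Z := \matrix_(i, j) ((g *m g^T) i j / (d 0 i + e 0 j)).
have lyap : diag_mx d *m Z + Z *m diag_mx e = g *m g^T.
  apply/matrixP=> i j; rewrite mxE mul_diag_mx mul_mx_diag.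
  rewrite [(\matrix_(_, _) _) i j]mxE [(\matrix_(_, _) _) i j in X in _ + X]mxE.
  rewrite [Z i j]mxE [(g *m g^T) i j]lock.
  have : 0 < d 0 i + e 0 j by rewrite !mxE; have := (d_ge0 i, d_ge0 j) => -[]; lra.
  by move=> ?; field; rewrite gt_eqF.
have Z_sym : Z^T = Z.
  apply/matrixP=> i j; rewrite !mxE; congr (_ / _); last by ring.
  by apply: eq_bigr => l _; rewrite !mxE mulrC.
(* Evaluating the equation as a quadratic form at [x] gives [|x g|^2 = 0]. *)
have kerZ (x : 'rV_k) : x *m Z = 0 -> x *m g = 0.
  move=> xZ; have Zx : Z *m x^T = 0 by rewrite -Z_sym -trmx_mul xZ trmx0.
  have : x *m (diag_mx d *m Z + Z *m diag_mx e) *m x^T = 0.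
    rewrite mulmxDr mulmxDl !mulmxA xZ !mul0mx addr0.
    by rewrite -[_ *m Z *m _]mulmxA Zx mulmx0.
  rewrite lyap => xgx; apply: row_dot_eq0.
  by rewrite trmx_mul !mulmxA in xgx *; rewrite xgx mxE.
have Z_unit : Z \in unitmx.
  rewrite -row_free_unit -kermx_eq0; apply/negPn/negP=> kerZ0.
  have kerg : kermx Z *m g = 0.
    apply/row_matrixP=> i; rewrite row_mul row0 kerZ //.
    by rewrite -row_mul mulmx_ker row0.
  have stab : stablemx (kermx Z) (diag_mx d).
    apply/sub_kermxP; move/(congr1 (mulmx (kermx Z))): lyap.
    by rewrite mulmxDr !mulmxA mulmx_ker kerg !mul0mx addr0.
  have [v [a [v0 vZ va]]] := sym_stable_eigenvector (tr_diag_mx d) stab kerZ0.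
  by case/eqP: v0; apply: ctrl va _; apply/kerZ/sub_kermxP.
exists (- g^T *m invmx Z) => z /eigenvalueP[y].
set H := _ + _ => yH y0.
have HZ : H *m Z = - (Z *m diag_mx e).
  rewrite mulmxDl -mulmxA mulmxKV // mulmxN -lyap.
  by rewrite opprD addrA subrr add0r.
pose w := y *m cmx Z.
have w0 : w != 0.
  by rewrite mulmx_free_eq0 // row_free_map row_free_unit.
have we : w *m cmx (diag_mx e) = - z *: w.
  rewrite scaleNr /w scalemxAl -yH -!mulmxA -!map_mxM HZ map_mxN mulmxN.
  exact/esym/opprK.
move: (w) w0 we => {}w w0 we; have [j wj0] := rV0Pn _ w0.
move/rowP/(_ j): we; rewrite map_diag_mx mul_mx_diag !mxE mulrC.
move=> /(mulIf wj0)/eqP; rewrite -eqr_oppLR => /eqP <-.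
by rewrite /= oppr_lt0; have := d_ge0 j; lra.
Qed.

(** The Popov-Belevitch-Hautus criterion for symmetric dynamics: only the
    eigenvectors of nonnegative eigenvalues need to be reached by the input. *)
Lemma sym_stabilizable n m (F : 'M[R]_n) (G : 'M[R]_(n, m)) :
    F^T = F ->
    (forall (v : 'rV_n) a, 0 <= a -> v *m F = a *: v -> v *m G = 0 -> v = 0) ->
  stabilizable F G.
Proof.
move=> F_sym ctrl.
have [k [V [d [[VV VF d_ge0] exhV]]]] :=
  exhausting_eigenframe F [pred a | 0 <= a].
have [|v a va vVG|L1 L1_hurwitz] := @diag_stabilizable k m d (V *m G).
- exact: d_ge0.
- have vVF : v *m V *m F = a *: (v *m V) by rewrite -mulmxA VF mulmxA va scalemxAl.
  have vE : v *m V *m V^T = v by rewrite -mulmxA VV mulmx1.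
  have [//|/rV0Pn[i vi0]] := eqVneq v 0.
  have a_ge0 : 0 <= a.
    move/rowP/(_ i): va; rewrite mul_mx_diag !mxE mulrC => /(mulIf vi0) <-.
    exact: d_ge0.
  by rewrite -vE (ctrl _ a a_ge0 vVF) ?mul0mx // -mulmxA.
exists (L1 *m V) => z /eigenvalueP[y yF y0].
(* The orthogonal projection off the rows of [V]; it commutes with [F] and kills
   the feedback, so [y *m P] is zero or an eigenvector of [F] alone. *)
pose P := 1%:M - V^T *m V.
have FV : F *m V^T = V^T *m diag_mx d.
  by apply: trmx_inj; rewrite !trmx_mul trmxK F_sym VF tr_diag_mx.
have FP : F *m P = P *m F.
  by rewrite mulmxBr mulmxBl mulmx1 mul1mx mulmxA FV -!mulmxA VF.
have VP : V *m P = 0 by rewrite mulmxBr mulmx1 mulmxA VV mul1mx subrr.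
have PV : P *m V^T = 0 by rewrite mulmxBl mul1mx -mulmxA VV mulmx1 subrr.
pose y' := y *m cmx P.
have yF' : y' *m cmx F = z *: y'.
  rewrite -mulmxA -map_mxM -FP [RHS]scalemxAl -yF -mulmxA -map_mxM.
  by rewrite mulmxDl -!mulmxA VP !mulmx0 addr0.
have [reF imF] := sym_complex_eigenvector F_sym yF'.
have [y'0|y'0] := eqVneq y' 0; last first.
  rewrite ltNge; apply: contra y'0 => z_ge0.
  by apply/eqP/complex_mx_eq0; [apply: exhV reF z_ge0 | apply: exhV imF z_ge0];
     rewrite /y' ?Remx_mul ?Immx_mul -mulmxA PV mulmx0.
(* Otherwise [y] lies in the row space of [V], where the closed loop acts as the
   diagonal one stabilized by [L1]. *)
pose c := y *m cmx V^T.
have yE : y = c *m cmx V.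
  by apply/eqP; rewrite -subr_eq0 -y'0 /y' map_mxB mulmxBr map_mx1 mulmx1
    map_mxM mulmxA.
apply: (L1_hurwitz z); apply/eigenvalueP; exists c; last first.
  by apply: contra_neq y0 => c0; rewrite yE c0 mul0mx.
rewrite {2}/c scalemxAl -yF [in RHS]yE -[RHS]mulmxA -[RHS]mulmxA -!map_mxM.
congr (_ *m cmx _).
by rewrite mulmxDl mulmxDr !mulmxA VF -!mulmxA VV !mulmx1.
Qed.

End SymmetricPBH.

(** * Columns produced by the selection *)

Section SelectedColumns.
Variables (R : realType) (N K : nat) (C : 'I_K -> {set 'I_N}).
Implicit Types (U : {vspace 'cV[R]_N}) (D : seq 'cV[R]_N).

Definition proj_span U D : {vspace 'cV[R]_N} := <<[seq oproj U c | c <- D]>>%VS.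

Definition cluster_balanced D : Prop :=
  forall c, c \in D -> forall l, \sum_(k in C l) c k 0 = 0.

(** The Popov-Belevitch-Hautus test, restricted to eigenvectors in [U]. *)
Definition excites U D : Prop :=
  forall v, v \in U -> (forall c, c \in D -> v^T *m c = 0) -> v = 0.

Lemma proj_count_le_dim U D : (proj_count U D <= \dim (proj_span U D))%N.
Proof.
apply/bigmax_leqP=> S /eqP; rewrite size_image => <-.
apply/dimvS/sub_span=> _ /imageP[j _ ->].
by apply: map_f; rewrite mem_nth.
Qed.

(** Each admissible column has a projection outside the span of the previous
    ones, so it raises the dimension of that span. *)
Lemma append_cols_spec U n D D' : append_cols C U n D D' ->
  [/\ {subset D <= D'}, cluster_balanced D -> cluster_balanced D'
    & (\dim (proj_span U D) + n <= \dim (proj_span U D'))%N].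
Proof.
elim=> {n D D'} [D|n D d D' [d0 dD bal_d] _ [sub bal dim]].
  by split=> //; rewrite addn0.
split.
- by move=> c Dc; apply: sub; rewrite mem_rcons inE Dc orbT.
- move=> bal_D; apply: bal => c; rewrite mem_rcons inE => /predU1P[-> //|].
  exact: bal_D.
apply: leq_trans dim; rewrite addnS -addSn leq_add2r.
have sDd : (proj_span U D <= proj_span U (rcons D d))%VS.
  by apply: sub_span => x; rewrite map_rcons mem_rcons inE => ->; rewrite orbT.
rewrite (ltn_leqif (dimv_leqif_sup sDd)); apply: contra dD => /subvP; apply.
by rewrite memv_span // map_rcons mem_rcons mem_head.
Qed.

(** Once the projections span [U], a vector of [U] orthogonal to the columns is
    orthogonal to their projections (a column and its projection have the same
    inner products with [U]), hence to itself. *)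
Lemma excites_of_dim U D :
  (\dim U <= \dim (proj_span U D))%N -> excites U D.
Proof.
move=> dimU v Uv vD; apply/eqP; rewrite -memv0 -(capv_orthv <[v]>) memv_cap.
rewrite memv_line /=.
have sU : (proj_span U D <= U)%VS.
  by apply/span_subvP=> _ /mapP[c _ ->]; case: (oprojP U c).
have /eqP spanU : proj_span U D == U by rewrite eqEdim sU.
suff /subvP : (proj_span U D <= orthv <[v]>)%VS by apply; rewrite spanU.
apply/span_subvP=> _ /mapP[c Dc ->].
apply/memv_orthv=> _ /vlineP[a ->]; have [_ /memv_orthv/(_ v Uv)] := oprojP U c.
rewrite mulmxBr vD // sub0r => /eqP; rewrite oppr_eq0 => /eqP vp.
by rewrite linearZ /= -scalemxAl vp scaler0.
Qed.

Lemma excites_sub U D D' : {subset D <= D'} -> excites U D -> excites U D'.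
Proof. by move=> sub exD v Uv vD'; apply: exD => // c /sub; apply: vD'. Qed.

(** The step for [l] completes the span of the projections on [Omega A C l], and
    columns are never removed, so what it achieves persists to the end. *)
Lemma selection_run_spec A ls D D' : selection_run C A ls D D' ->
  [/\ {subset D <= D'}, cluster_balanced D -> cluster_balanced D'
    & {in ls, forall l, excites (Omega A C l) D'}].
Proof.
elim=> {ls D D'} [D|l ls D D' D'' app _ [sub' bal' ex']]; first by split.
have [sub bal dim] := append_cols_spec app.
split=> [c /sub/sub' //|/bal/bal' //|i]; rewrite inE => /predU1P[->|]; last exact: ex'.
apply: excites_sub sub' _; apply: excites_of_dim; apply: leq_trans dim.
by rewrite -leq_subLR leq_sub2l // proj_count_le_dim.
Qed.

Lemma Tpar_balanced D : cluster_balanced D -> Tpar R C *m mx_of_cols D = 0.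
Proof.
move=> bal; apply/matrixP=> l j; rewrite !mxE.
under eq_bigr do rewrite !mxE.
rewrite (bigID (mem (C l))) /= [X in _ + X]big1 => [|k /negPf->]; last exact: mul0r.
rewrite addr0; under eq_bigr => k -> do idtac.
by rewrite -mulr_sumr bal ?mulr0 // mem_nth.
Qed.

End SelectedColumns.

(** * Invariance of the consensus subspace *)

Section ClusterSubspace.
Variables (R : realType) (N M K : nat) (A : 'M[R]_N) (B : 'M[R]_(N, M)).
Variables (C : 'I_K -> {set 'I_N}).
Hypothesis C_clusters : cluster_enum A B C.

Lemma aut_entry s i j : s \in Defs.aut A B -> A (s i) (s j) = A i j.
Proof.
rewrite inE => /andP[/eqP sA _].
have : (perm_mx s *m A) i (s j) = (A *m perm_mx s) i (s j) by rewrite sA.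
by rewrite -row_permE -[X in _ *m perm_mx X]invgK -col_permE !mxE permK.
Qed.

Lemma cluster_orbit j i : i \in C j -> C j = orbit 'P (Defs.aut A B) i.
Proof.
case: C_clusters => _ eC Cji.
have : C j \in clusters A B by rewrite -eC imset_f.
by case/imsetP=> k _ Ck; rewrite Ck in Cji *; apply/esym/orbit_eqP.
Qed.

Lemma Xor_aut (x : 'cV[R]_N) s i :
  x \in Xor R C -> s \in Defs.aut A B -> x (s i) 0 = x i 0.
Proof.
case: C_clusters => _ eC /memv_Xor Xx sA.
have : orbit 'P (Defs.aut A B) i \in clusters A B by apply: imset_f.
rewrite -eC => /imsetP[j _ Cj].
by apply: (Xx j); rewrite -Cj ?orbit_refl // (mem_orbit 'P i sA).
Qed.

(** Entrywise, [A] is unchanged when an automorphism relabels rows and columns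
    together, and [x] is unchanged by the same relabelling. *)
Lemma Xor_stable (x : 'cV[R]_N) : x \in Xor R C -> A *m x \in Xor R C.
Proof.
move=> Xx; apply/memv_Xor=> j i l Ci; rewrite (cluster_orbit Ci).
case/orbitP=> s sA <-; rewrite /= !mxE [RHS](reindex_perm s) /=.
by apply: eq_bigr => k _; rewrite aut_entry // Xor_aut.
Qed.

Lemma Tpar_row_Xor j : (row j (Tpar R C))^T \in Xor R C.
Proof.
apply/memv_Xor=> k i l Ci Cl; rewrite !mxE.
suff -> : (i \in C j) = (l \in C j) by [].
have same p q : p \in C k -> q \in C k -> p \in C j -> q \in C j.
  by move=> Cp Cq /cluster_orbit ->; rewrite -(cluster_orbit Cp).
by apply/idP/idP; apply: same.
Qed.

End ClusterSubspace.

(** * The transverse block *)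

Section IrreducibleTransformation.
Variables (R : realType) (N M K : nat) (A : 'M[R]_N) (B : 'M[R]_(N, M)).
Variables (C : 'I_K -> {set 'I_N}) (Tperp : 'M[R]_(N - K, N)).
Hypotheses (A_sym : A^T = A) (C_clusters : cluster_enum A B C).
Hypothesis Tperp_irr : irr_transformation C Tperp.

Lemma Tperp_Xor (x : 'cV[R]_N) : x \in Xor R C -> Tperp *m x = 0.
Proof.
case: Tperp_irr => _ _ basis _ Xx; apply/row_matrixP=> i; rewrite row0 row_mul.
have /(basis_mem basis)/memv_orthv/(_ x Xx) :
    (row i Tperp)^T \in [seq (row i Tperp)^T | i : 'I_(N - K)].
  exact: image_f.
by rewrite -trmx_mul => /(congr1 trmx); rewrite trmxK trmx0.
Qed.

(** The columns of [Tpar^T] are constant on clusters, [A] keeps them so, and the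
    rows of [Tperp] are orthogonal to all such vectors. *)
Lemma Tperp_A_Tpar : Tperp *m A *m (Tpar R C)^T = 0.
Proof.
apply/trmx_inj/row_matrixP=> j; rewrite trmx0 row0 !trmx_mul trmxK !row_mul.
apply: trmx_inj; rewrite !trmx_mul !trmxK trmx0.
by rewrite -mulmxA Tperp_Xor // (Xor_stable C_clusters) // (Tpar_row_Xor C_clusters).
Qed.

Lemma AperpE : Aperp A C Tperp = Tperp *m A *m Tperp^T.
Proof.
by rewrite /Aperp /Tor tr_col_mx mul_col_mx mul_col_row block_mxKdr.
Qed.

Lemma Aperp_sym : (Aperp A C Tperp)^T = Aperp A C Tperp.
Proof. by rewrite AperpE !trmx_mul trmxK A_sym mulmxA. Qed.

(** Insert [1 = Tpar^T *m Tpar + Tperp^T *m Tperp] on the right of [Tperp *m A]: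
    the mixed block vanishes. This transfers left eigenvectors of the transverse
    block to [A]. *)
Lemma Aperp_intertwine : Aperp A C Tperp *m Tperp = Tperp *m A.
Proof.
case: Tperp_irr => _; rewrite /Tor tr_col_mx mul_row_col => TT _ _.
rewrite -[RHS]mulmx1 -TT mulmxDr !mulmxA Tperp_A_Tpar mul0mx add0r.
by rewrite AperpE.
Qed.

Lemma Tperp_orthonormal : Tperp *m Tperp^T = 1%:M.
Proof.
case: Tperp_irr; rewrite /Tor tr_col_mx mul_col_row => TT _ _ _.
by move/(congr1 drsubmx): TT; rewrite scalar_mx_block !block_mxKdr.
Qed.

Lemma lift_eigenvector (w : 'rV[R]_(N - K)) a :
  w *m Aperp A C Tperp = a *: w -> (w *m Tperp)^T \in Omega A C a.
Proof.
move=> wA; apply/memv_Omega; split=> [|x Xx].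
  rewrite -{1}A_sym -trmx_mul -mulmxA -Aperp_intertwine mulmxA wA.
  by rewrite -scalemxAl linearZ.
by rewrite -trmx_mul -mulmxA Tperp_Xor // mulmx0 trmx0.
Qed.

Lemma eigenvalue_Lambda_perp (w : 'rV[R]_(N - K)) a :
  w *m Aperp A C Tperp = a *: w -> w != 0 -> 0 <= a -> a \in Lambda_perp A C Tperp.
Proof.
move=> wA w0 a0; rewrite inE a0 /=; apply/andP; split; apply/eigenvalueP.
  exists (w *m Tperp).
    by rewrite -mulmxA -Aperp_intertwine mulmxA wA scalemxAl.
  by apply: contra_neq w0 => wT; rewrite -[w]mulmx1 -Tperp_orthonormal mulmxA wT mul0mx.
by exists w.
Qed.

End IrreducibleTransformation.

Theorem theorem4 (R : realType) (N M K : nat)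
    (A : 'M[R]_N) (B : 'M[R]_(N, M))
    (C : 'I_K -> {set 'I_N}) (Tperp : 'M[R]_(N - K, N))
    (lam : seq R) (D : seq 'cV[R]_N)
    (A_sym : A^T = A)
    (B_01 : forall i j, B i j = 0 \/ B i j = 1)
    (C_clusters : cluster_enum A B C)
    (Tperp_irr : irr_transformation C Tperp)
    (lam_enum : Lambda_perp_enum A C Tperp lam)
    (D_selected : selected C A lam D) :
  Tpar R C *m mx_of_cols D = 0 /\
  stabilizable (Aperp A C Tperp) (Tperp *m mx_of_cols D).
Proof.
have [_ balD exD] := selection_run_spec D_selected.
split; first by apply: Tpar_balanced; apply: balD.
apply: sym_stabilizable => [|w a a_ge0 wA wD]; first exact: Aperp_sym.
apply/eqP/negPn/negP=> w0.
have lam_a : a \in lam.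
  by case: lam_enum => _ ->; exact: (eigenvalue_Lambda_perp C_clusters Tperp_irr wA).
have wT0 : (w *m Tperp)^T = 0.
  apply: (exD a lam_a) => [|c /(nthP 0)[j ltj <-]].
    exact: (lift_eigenvector A_sym C_clusters Tperp_irr wA).
  rewrite trmxK; move: wD; rewrite mulmxA; move: (w *m Tperp) => y.
  move=> /rowP/(_ (Ordinal ltj)) yD; apply/rowP=> i; rewrite ord1.
  move: yD; rewrite !mxE => yD; rewrite -[RHS]yD.
  by apply: eq_bigr => k _; rewrite mxE.
case/eqP: w0; rewrite -[w]mulmx1 -(Tperp_orthonormal Tperp_irr) mulmxA.
by rewrite -[w *m Tperp]trmxK wT0 trmx0 mul0mx.
Qed.
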